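(* Let $n\ge 2$. (1) For $a=-\tfrac{n}{n+1}$, the graph of the function $$f(x)=-\tfrac14\ln\Big(x_1-\sum_{k=2}^n\tfrac{x_k^2}{2}\Big),\qquad \text{defined on } \Big\{x\in\mathbb{R}^n: x_1>\sum_{k=2}^n\tfrac{x_k^2}{2}\Big\},$$ is a non-quadratic (i.e. $f$ is not a quadratic polynomial), Euclidean complete and Calabi complete affine maximal type hypersurface with exponent $a$. Moreover $f$ satisfies the Abreu equation with scalar curvature $L^\sharp=-4(n+1)$. (2) For $a=-\tfrac{1}{n+1}$, the graph of the function $$f(x)=-\tfrac14\ln x_1+\sum_{k=2}^n\tfrac{x_k^2}{2x_1},\qquad \text{defined on } \{x\in\mathbb{R}^n: x_1>0\},$$ is a non-quadratic, Euclidean complete and Calabi complete affine maximal type hypersurface with exponent $a$. Moreover $f$ satisfies the Abreu equation with scalar curvature $L^\sharp=-4n(n+1)$.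
   Context: Let $f$ be a smooth strictly convex function (positive definite Hessian) on a convex domain $\Omega\subset\mathbb{R}^n$. Write $f_{ij}=\frac{\partial^2 f}{\partial x_i\partial x_j}$, $(f^{ij})=(f_{ij})^{-1}$, and let $(F^{ij})$ be the cofactor matrix of the Hessian matrix $(f_{ij})$. For a constant $a\ne0$, put $w=[\det(f_{ij})]^a$, and write $w_{ij}=\frac{\partial^2 w}{\partial x_i\partial x_j}$. The graph $\{(x,f(x)):x\in\Omega\}\subset\mathbb{R}^{n+1}$ is an affine maximal type hypersurface with exponent $a$ if $f$ satisfies the affine maximal type equation $\sum_{i,j=1}^n f^{ij}w_{ij}=0$ on $\Omega$. The function $f$ satisfies the Abreu equation with scalar curvature $L^\sharp$ if, with $a=-1$ (i.e. $w=[\det(f_{ij})]^{-1}$), one has $\sum_{i,j=1}^n F^{ij}w_{ij}=-L^\sharp$ on $\Omega$. Euclidean complete means that the graph is complete with respect to the Riemannian metric induced from the Euclidean metric of $\mathbb{R}^{n+1}$. Calabi complete means that the Calabi metric $G=\sum f_{ij}\,dx_i dx_j$ is a complete Riemannian metric (on $\Omega$, equivalently on the graph). *)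

(* Defs.v *)
From HB Require Import structures.
From mathcomp Require Import all_boot all_order all_algebra.
From mathcomp Require Import all_classical all_reals all_analysis.

Set Implicit Arguments.
Unset Strict Implicit.
Unset Printing Implicit Defensive.

Import Order.TTheory GRing.Theory Num.Theory.
Import numFieldNormedType.Exports.

Local Open Scope classical_set_scope.
Local Open Scope ring_scope.

Definition partial (R : realType) (n : nat) (i : 'I_n) (f : 'rV[R]_n -> R) :
    'rV[R]_n -> R :=
  fun x => 'D_(delta_mx 0 i) f x.

Definition iter_partial (R : realType) (n : nat) (s : seq 'I_n)
    (f : 'rV[R]_n -> R) : 'rV[R]_n -> R :=
  foldr (@partial R n) f s.

(* C^oo on the open set Omega: the partial derivatives of all orders exist and
   are continuous at every point of Omega. *)
Definition smooth_on (R : realType) (n : nat) (Omega : set 'rV[R]_n)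
    (f : 'rV[R]_n -> R) : Prop :=
  forall (s : seq 'I_n) (x : 'rV[R]_n), Omega x ->
    {for x, continuous (iter_partial s f)} /\
    (forall i : 'I_n, derivable (iter_partial s f) x (delta_mx 0 i)).

Definition hessian (R : realType) (n : nat) (f : 'rV[R]_n -> R)
    (x : 'rV[R]_n) : 'M[R]_n :=
  \matrix_(i, j) partial i (partial j f) x.

Definition quad_form (R : realType) (m : nat) (A : 'M[R]_m) (v : 'rV[R]_m) : R :=
  (v *m A *m v^T) 0 0.

Definition convex_domain (R : realType) (n : nat) (Omega : set 'rV[R]_n) : Prop :=
  [/\ open Omega, Omega !=set0 & convex_set Omega].

(* Symmetry of the Hessian is not required: it follows from smoothness. *)
Definition smooth_strictly_convex (R : realType) (n : nat)
    (Omega : set 'rV[R]_n) (f : 'rV[R]_n -> R) : Prop :=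
  [/\ convex_domain Omega, smooth_on Omega f &
      forall x, Omega x -> forall v : 'rV[R]_n, v != 0 ->
        0 < quad_form (hessian f x) v].

Definition det_hess_pow (R : realType) (n : nat) (a : R) (f : 'rV[R]_n -> R) :
    'rV[R]_n -> R :=
  fun x => (\det (hessian f x)) `^ a.

Definition affine_maximal_type (R : realType) (n : nat) (a : R)
    (Omega : set 'rV[R]_n) (f : 'rV[R]_n -> R) : Prop :=
  [/\ a != 0, smooth_strictly_convex Omega f &
      forall x, Omega x ->
        \sum_(i < n) \sum_(j < n)
          invmx (hessian f x) i j * hessian (det_hess_pow a f) x i j = 0].

Definition abreu (R : realType) (n : nat) (Omega : set 'rV[R]_n)
    (f : 'rV[R]_n -> R) (L : R) : Prop :=
  smooth_strictly_convex Omega f /\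
  forall x, Omega x ->
    \sum_(i < n) \sum_(j < n)
      cofactor (hessian f x) i j * hessian (det_hess_pow (-1) f) x i j = - L.

Definition quadratic_on (R : realType) (n : nat) (Omega : set 'rV[R]_n)
    (f : 'rV[R]_n -> R) : Prop :=
  exists (A : 'M[R]_n) (b : 'rV[R]_n) (c : R), forall x, Omega x ->
    f x = quad_form A x + (b *m x^T) 0 0 + c.

(* Riemannian distance on an embedded submanifold M of R^m.  The metric at
   p in M is the restriction to T_p M of the bilinear form with Gram matrix
   g p.  A piecewise C^1 curve in M is encoded as a finite chain of C^1 arcs
   parametrized by [0, 1], each starting where the previous one ends; this loses
   nothing since length is invariant under reparametrization.  Only the
   values of an arc on [0, 1] matter; the two-sided derivatives at 0 and 1 are
   harmless as a C^1 curve on [0, 1] extends to a C^1 curve in R^m. *)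
Definition C1_arc (R : realType) (m : nat) (M : set 'rV[R]_m)
    (c : R -> 'rV[R]_m) : Prop :=
  [/\ forall t : R, t \in `[0, 1] -> M (c t),
      forall t : R, t \in `[0, 1] -> derivable c t 1 &
      {within `[0, 1], continuous (derive1 c)}].

Definition arc_length (R : realType) (m : nat) (g : 'rV[R]_m -> 'M[R]_m)
    (c : R -> 'rV[R]_m) : R :=
  \int[lebesgue_measure]_(t in `[0, 1])
    Num.sqrt (quad_form (g (c t)) (derive1 c t)).

Fixpoint C1_chain (R : realType) (m : nat) (M : set 'rV[R]_m)
    (x : 'rV[R]_m) (s : seq (R -> 'rV[R]_m)) (y : 'rV[R]_m) : Prop :=
  if s is c :: s' then [/\ C1_arc M c, c 0 = x & C1_chain M (c 1) s' y]
  else x = y.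

Definition riem_dist (R : realType) (m : nat) (M : set 'rV[R]_m)
    (g : 'rV[R]_m -> 'M[R]_m) (x y : 'rV[R]_m) : \bar R :=
  ereal_inf [set (\sum_(c <- s) arc_length g c)%:E | s in
    [set s : seq (R -> 'rV[R]_m) | C1_chain M x s y]].

Definition riem_complete (R : realType) (m : nat) (M : set 'rV[R]_m)
    (g : 'rV[R]_m -> 'M[R]_m) : Prop :=
  forall u : nat -> 'rV[R]_m, (forall k, M (u k)) ->
    (forall e : R, 0 < e -> exists N : nat, forall p q : nat,
       (N <= p)%N -> (N <= q)%N -> (riem_dist M g (u p) (u q) < e%:E)%E) ->
    exists2 x, M x & riem_dist M g (u k) x @[k --> \oo] --> 0%E.

Definition graph_of (R : realType) (n : nat) (Omega : set 'rV[R]_n)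
    (f : 'rV[R]_n -> R) : set 'rV[R]_(n + 1) :=
  [set row_mx x (f x)%:M | x in Omega].

Definition euclidean_complete (R : realType) (n : nat) (Omega : set 'rV[R]_n)
    (f : 'rV[R]_n -> R) : Prop :=
  riem_complete (graph_of Omega f) (fun=> 1%:M).

Definition calabi_complete (R : realType) (n : nat) (Omega : set 'rV[R]_n)
    (f : 'rV[R]_n -> R) : Prop :=
  riem_complete Omega (hessian f).

(* Main.v *)
Require Import Defs.
From HB Require Import structures.
From mathcomp Require Import all_boot all_order all_algebra.
From mathcomp Require Import all_classical all_reals all_analysis.
From mathcomp Require Import ring lra.

(** Both functions are members of one family.  With
<<  u = x_1 - r * sum_(k != 1) x_k^2 / 2,
    f = - (1/4) ln u + s * sum_(k != 1) x_k^2 / (2 u)  >>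
the first one is (r, s) = (1, 0) and the second one is (r, s) = (0, 1); in both
cases the domain is [u > 0] and [r s = 0].  The Hessian of [f] is diagonal in the
coframe [du], [omega_k = dx_k - s x_k du / u]:
<<  Hess f = du^2 / (4 u^2) + (r/4 + s) / u * sum_(k != 1) omega_k^2.  >>
The change of basis [L] to this coframe is unitriangular, so that
[det (Hess f)] is a constant times [u^-(n+1)] and [w = det^a] is a constant times
a power of [u].  The Hessian of [K u^p] is diagonal in the same coframe, because
[r omega_k = r dx_k].  Hence [sum f^ij w_ij] is the sum of the ratios of the diagonal
coefficients, [4 K p u^p ((p - 1) - r (n - 1))]: it vanishes for [p = n] when [r = 1]
and for [p = 1] when [r = 0], and [p = n + 1] gives the two scalar curvatures
([hessian_potential], [hessian_height_power], [sum_weight_ratio]).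

The Calabi metric is a hyperbolic metric in disguise, and its completeness is proved
by exhibiting enough globally Lipschitz functions.  A function [h] with
[|dh(v)| <= C sqrt (g(v, v))] satisfies [|h x - h y| <= C d(x, y)]
([lipschitz_riem_dist]), so it converges along a Cauchy sequence.  Here [ln u] and
[asinh (x_k / sqrt u)] are Lipschitz ([dln_height_bound], [dasinh_ratio_bound]), and
these functions are global coordinates of the domain.  A Cauchy sequence thus
converges in the usual topology to a point of the domain, and it also converges for the
Riemannian distance since the segments joining it to its limit are eventually short
([riem_dist_cvg0]).

For the Euclidean metric of the graph, the coordinates of the ambient space are
1-Lipschitz.  The limit of a Cauchy sequence remains above the domain because
[u >= exp (- 4 f)]: the function [f] blows up at the boundary
([euclidean_complete_blowup]).

All functions involved are built from coordinates by field operations, [expR] and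
[ln]; the inductive predicate [elementary] carries a function of this kind together with
its differential.  Such a class is stable under differentiation, whence the smoothness. *)

Set Implicit Arguments.
Unset Strict Implicit.
Unset Printing Implicit Defensive.

Import Order.TTheory GRing.Theory Num.Theory.
Import numFieldNormedType.Exports.

Local Open Scope classical_set_scope.
Local Open Scope ring_scope.

(** * Elementary functions and their differentials *)

(** [elementary M f df] asserts that the expression [f] makes sense on [M] and that
[df x v] is what the rules of calculus give for the differential of [f] at [x] applied
to [v].  Equality of [f] and [df] with simpler expressions is reached by extensionality
([elementary_ext]), so explicit derivatives are found by algebra alone.  The set [M]
is arbitrary since it is a graph in the Euclidean part of the proof. *)
Inductive elementary (R : realType) (m : nat) (M : set 'rV[R]_m) :
    ('rV[R]_m -> R) -> ('rV[R]_m -> 'rV[R]_m -> R) -> Prop :=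
| elementary_cst (a : R) : elementary M (fun=> a) (fun _ _ => 0)
| elementary_coord (i : 'I_m) :
    elementary M (fun x => x 0 i) (fun _ v => v 0 i)
| elementaryD f df g dg : elementary M f df -> elementary M g dg ->
    elementary M (fun x => f x + g x) (fun x v => df x v + dg x v)
| elementaryM f df g dg : elementary M f df -> elementary M g dg ->
    elementary M (fun x => f x * g x) (fun x v => f x * dg x v + g x * df x v)
| elementaryV f df : elementary M f df -> (forall x, M x -> f x != 0) ->
    elementary M (fun x => (f x)^-1)
      (fun x v => - ((f x)^-1 * (f x)^-1) * df x v)
| elementary_expR f df : elementary M f df ->
    elementary M (fun x => expR (f x)) (fun x v => expR (f x) * df x v)
| elementary_ln f df : elementary M f df -> (forall x, M x -> 0 < f x) ->
    elementary M (fun x => ln (f x)) (fun x v => (f x)^-1 * df x v).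

Section elementary_theory.
Context (R : realType) (m : nat) (M : set 'rV[R]_m).
Implicit Types (f g : 'rV[R]_m -> R) (df dg : 'rV[R]_m -> 'rV[R]_m -> R).

(** The equalities are required everywhere, not only on [M]: as [M] may fail to be
open, values on [M] do not determine a differential. *)
Lemma elementary_ext f df g dg :
  elementary M f df -> f =1 g -> df =2 dg -> elementary M g dg.
Proof.
move=> fdf /funext <- dfdg; suff <- : df = dg by [].
by apply/funext => x; apply/funext => v.
Qed.

Lemma elementary_diff f df x : elementary M f df -> M x ->
  differentiable f x /\ forall v, 'd f x v = df x v.
Proof.
move=> fdf; elim: fdf x => {f df}
    [a|i|f df g dg _ IHf _ IHg|f df g dg _ IHf _ IHg|f df _ IHf f0|f df _ IHf
    |f df _ IHf f0] x Mx.
- by split=> [|v]; [exact: differentiable_cst|rewrite diff_cst].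
- split; first exact: differentiable_coord.
  move=> v; have lin : linear (fun y : 'rV[R]_m => y 0 i) by move=> a y z; rewrite !mxE.
  pose c : {linear 'rV[R]_m -> R} :=
    HB.pack (fun y : 'rV[R]_m => y 0 i) (GRing.isLinear.Build _ _ _ _ _ lin).
  by rewrite (_ : (fun _ => _) = c) // diff_lin//; exact: coord_continuous.
- have [df1 df2] := IHf x Mx; have [dg1 dg2] := IHg x Mx.
  split=> [|v]; first exact: differentiableD.
  by rewrite (diffD df1 dg1) /= -df2 -dg2.
- have [df1 df2] := IHf x Mx; have [dg1 dg2] := IHg x Mx.
  split=> [|v]; first exact: differentiableM.
  by rewrite (diffM df1 dg1) /= -df2 -dg2.
- have [df1 df2] := IHf x Mx.
  split=> [|v]; first exact/differentiableV/f0.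
  by rewrite (diffV df1 (f0 x Mx)) /= -df2 -[_ *: _]/(_ * _) expr2 invfM.
- have [df1 df2] := IHf x Mx.
  have de : differentiable (@expR R) (f x).
    exact/derivable1_diffP/derivable_expR.
  split=> [|v]; first exact: differentiable_comp.
  rewrite (diff_comp df1 de) /= diff1E// -df2 derive1E.
  by have [_ ->] := is_derive_expR (f x); rewrite mulrC.
- have [df1 df2] := IHf x Mx.
  have il : is_derive (f x) 1 (@ln R) (f x)^-1 by exact/is_derive1_ln/f0.
  have de : differentiable (@ln R) (f x) by exact/derivable1_diffP/ex_derive.
  split=> [|v]; first exact: differentiable_comp.
  rewrite (diff_comp df1 de) /= diff1E// -df2 derive1E.
  by have [_ ->] := il; rewrite mulrC.
Qed.

Lemma elementary_derive f df x v : elementary M f df -> M x ->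
  'D_v f x = df x v.
Proof.
by move=> fdf /(elementary_diff fdf)[fx <-]; rewrite deriveE.
Qed.

Lemma elementary_sum_delta f df x v : elementary M f df -> M x ->
  df x v = \sum_i v 0 i * df x (delta_mx 0 i).
Proof.
move=> fdf /(elementary_diff fdf)[_ dfE].
rewrite -dfE {1}(row_sum_delta v) linear_sum.
by apply: eq_bigr => i _; rewrite linearZ /= dfE.
Qed.

Lemma elementary_derivable f df x v : elementary M f df -> M x ->
  derivable f x v.
Proof. by move=> fdf /(elementary_diff fdf)[fx _]; exact: diff_derivable. Qed.

Lemma elementary_derive_line f df x v (t : R) : elementary M f df ->
  M (t *: v + x) ->
  is_derive t (1 : R) (fun s : R => f (s *: v + x)) (df (t *: v + x) v).
Proof.
move=> fdf /(elementary_diff fdf)[df1 df2].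
have dl : is_diff t (fun s : R => s *: v) (fun s : R => s *: v).
  exact: is_diff_scalel.
pose p : R -> 'rV[R]_m := (fun s : R => s *: v) + cst x.
have [dp dpE] : is_diff t p ((fun s : R => s *: v) + 0).
  exact: is_diffD dl (is_diff_cst x t).
have dc : differentiable (f \o p) t by exact: differentiable_comp.
constructor; first exact/derivable1_diffP.
rewrite deriveE; last exact: dc.
rewrite (diff_comp dp df1) /= dpE df2 /=; congr (df _ _).
by rewrite /GRing.add /= addr0 scale1r.
Qed.

Lemma elementary_continuous f df x : elementary M f df -> M x ->
  {for x, continuous f}.
Proof.
by move=> fdf /(elementary_diff fdf)[fx _]; exact: differentiable_continuous.
Qed.

Lemma elementaryN f df : elementary M f df ->
  elementary M (fun x => - f x) (fun x v => - df x v).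
Proof.
move=> fdf; apply: elementary_ext (elementaryM (elementary_cst M (-1)) fdf) _ _.
  by move=> x /=; rewrite mulN1r.
by move=> x v /=; rewrite mulN1r mulr0 addr0.
Qed.

Lemma elementaryB f df g dg : elementary M f df -> elementary M g dg ->
  elementary M (fun x => f x - g x) (fun x v => df x v - dg x v).
Proof. by move=> fdf /elementaryN; exact: elementaryD. Qed.

Lemma elementaryX f df k : elementary M f df ->
  elementary M (fun x => f x ^+ k) (fun x v => k%:R * f x ^+ k.-1 * df x v).
Proof.
move=> fdf; elim: k => [|k IH].
  apply: elementary_ext (elementary_cst M 1) _ _ => //.
  by move=> x v; rewrite !mul0r.
apply: elementary_ext (elementaryM fdf IH) _ _ => [x|x v] /=.
  by rewrite exprS.
case: k {IH} => [|k] /=; first by rewrite expr0; ring.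
by rewrite -!natr1 exprS; ring.
Qed.

Lemma elementary_sum (I : Type) (r : seq I) (P : pred I)
    (F : I -> 'rV[R]_m -> R) (dF : I -> 'rV[R]_m -> 'rV[R]_m -> R) :
  (forall k, P k -> elementary M (F k) (dF k)) ->
  elementary M (fun x => \sum_(k <- r | P k) F k x)
    (fun x v => \sum_(k <- r | P k) dF k x v).
Proof.
move=> FdF; elim: r => [|k r IH].
  apply: elementary_ext (elementary_cst M 0) _ _ => [x|x v];
  by rewrite big_nil.
have [Pk|nPk] := boolP (P k).
  apply: elementary_ext (elementaryD (FdF k Pk) IH) _ _ => [x|x v];
  by rewrite big_cons Pk.
apply: elementary_ext IH _ _ => [x|x v]; by rewrite big_cons (negbTE nPk).
Qed.

(** The rules of calculus express the differential with the operations that built the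
function; by iteration, all partial derivatives stay in the class. *)
Lemma elementary_differential f df (v : 'rV[R]_m) : elementary M f df ->
  exists ddf, elementary M (fun x => df x v) ddf.
Proof.
elim=> {f df}
    [a|i|f df g dg _ [ddf ?] _ [ddg ?]
    |f df g dg ? [ddf ?] ? [ddg ?]
    |f df ? [ddf ?] f0|f df ? [ddf ?]
    |f df ? [ddf ?] f0]; eexists.
- exact: elementary_cst.
- exact: elementary_cst.
- by apply: elementaryD; eassumption.
- by apply: elementaryD; apply: elementaryM; eassumption.
- apply: elementaryM; last eassumption.
  by apply: elementaryN; apply: elementaryM; apply: elementaryV; eassumption.
- by apply: elementaryM; [apply: elementary_expR|]; eassumption.
- apply: elementaryM; last eassumption.
  apply: elementaryV; first eassumption.
  by move=> x /f0 /lt0r_neq0.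
Qed.

Hypothesis oM : open M.

(** The determinant of the Hessian raised to a real power is only computed on the
domain; its derivatives are those of the resulting expression since they depend on
germs. *)
Lemma partial_eq_on f g i x : (forall y, M y -> f y = g y) -> M x ->
  partial i f x = partial i g x.
Proof.
move=> fg Mx; apply: near_eq_derive; near=> y; apply: fg; near: y.
exact: open_nbhs_nbhs.
Unshelve. all: by end_near. Qed.

Lemma hessian_eq_on f g x : (forall y, M y -> f y = g y) -> M x ->
  hessian f x = hessian g x.
Proof.
move=> fg Mx; apply/matrixP => i j; rewrite [LHS]mxE [RHS]mxE.
by apply: partial_eq_on => // y; exact: partial_eq_on.
Qed.

(** By induction on the list of partial derivatives: on the open set [M], an iterated
partial derivative agrees with an elementary function, hence has the same germs. *)
Lemma elementary_smooth f df : elementary M f df -> smooth_on M f.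
Proof.
move=> fdf s x Mx.
suff [g [dg [gdg gE]]] : exists g dg,
    elementary M g dg /\ forall y, M y -> iter_partial s f y = g y.
  have near_g : \forall y \near x, g y = iter_partial s f y.
    by near=> y; rewrite gE//; near: y; exact: open_nbhs_nbhs.
  split=> [|i]; last first.
    by apply: (near_eq_derivable near_g); exact: elementary_derivable gdg Mx.
  rewrite /prop_for /continuous_at gE//.
  exact: cvg_trans (near_eq_cvg near_g) (elementary_continuous gdg Mx).
elim: s {x Mx} => [|i s [g [dg [gdg gE]]]]; first by exists f, df.
have [ddg ddgE] := elementary_differential (delta_mx 0 i) gdg.
exists (fun x => dg x (delta_mx 0 i)), ddg; split => // y My.
by rewrite /= (partial_eq_on _ gE)// /partial (elementary_derive _ gdg).
Unshelve. all: by end_near. Qed.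

Lemma hessian_elementary f df i j ddf x : elementary M f df ->
  elementary M (fun x => df x (delta_mx 0 j)) ddf -> M x ->
  hessian f x i j = ddf x (delta_mx 0 i).
Proof.
move=> fdf ddfE Mx; rewrite mxE.
rewrite (@partial_eq_on _ (fun x => df x (delta_mx 0 j)))//.
  exact: elementary_derive ddfE Mx.
by move=> y My; exact: elementary_derive fdf My.
Qed.

Lemma elementary_hessian_continuous f df i j x : elementary M f df -> M x ->
  {for x, continuous (fun y => hessian f y i j)}.
Proof.
move=> /elementary_smooth fs Mx.
have [c _] := fs [:: i; j] x Mx.
suff -> : (fun y => hessian f y i j) = iter_partial [:: i; j] f by [].
by apply/funext => y; rewrite mxE.
Qed.

End elementary_theory.

(** * Matrices diagonalized by a common congruence *)
Section congruence_diagonal.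
Context (R : realType) (n : nat).
Implicit Types (L : 'M[R]_n) (d e v : 'rV[R]_n).

Lemma congr_diagE L d i j :
  (L *m diag_mx d *m L^T) i j = \sum_k d 0 k * L i k * L j k.
Proof.
rewrite mxE; apply: eq_bigr => k _.
by rewrite mul_mx_diag !mxE (mulrC (d 0 k)).
Qed.

Lemma quad_form_congr_diag L d v :
  quad_form (L *m diag_mx d *m L^T) v = \sum_k d 0 k * (v *m L) 0 k ^+ 2.
Proof.
rewrite /quad_form !mulmxA -(mulmxA _ L^T) -trmx_mul mxE.
set w := v *m L; apply: eq_bigr => k _.
by rewrite mul_mx_diag !mxE mulrAC mulrC -expr2.
Qed.

Lemma quad_form_congr_diag_gt0 L d v : L \in unitmx -> (forall k, 0 < d 0 k) ->
  v != 0 -> 0 < quad_form (L *m diag_mx d *m L^T) v.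
Proof.
move=> Lu d0 v0; rewrite quad_form_congr_diag.
have [k vLk] : exists k, (v *m L) 0 k != 0.
  apply/existsP; rewrite -negb_forall; apply: contra v0 => /forallP vL0.
  rewrite -[v](mulmxK Lu) (_ : v *m L = 0) ?mul0mx//.
  by apply/rowP => k; rewrite [RHS]mxE; exact/eqP.
rewrite (bigD1 k)//= ltr_pwDl//.
  by rewrite mulr_gt0// exprn_even_gt0.
by apply: sumr_ge0 => i _; rewrite mulr_ge0 ?sqr_ge0// ltW.
Qed.

Lemma det_congr_diag L d : \det L = 1 ->
  \det (L *m diag_mx d *m L^T) = \prod_k d 0 k.
Proof. by move=> L1; rewrite !det_mulmx det_tr L1 mul1r mulr1 det_diag. Qed.

(** For [H = L D L^T] and [W = L E L^T], the matrix [H^-1 W] is conjugate to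
[D^-1 E], so that the contraction of [W] with [H^-1] does not involve [L]. *)
Lemma tr_invmx_congr_diag L d e : \det L = 1 -> (forall k, d 0 k != 0) ->
  \sum_i \sum_j invmx (L *m diag_mx d *m L^T) i j * (L *m diag_mx e *m L^T) i j =
  \sum_k e 0 k / d 0 k.
Proof.
move=> L1 d0.
have Lu : L \in unitmx by rewrite unitmxE L1 unitr1.
have Du : diag_mx d \in unitmx.
  by rewrite unitmxE det_diag unitfE; apply/prodf_neq0 => k _.
set H := L *m diag_mx d *m L^T; set W := L *m _ *m L^T.
have WT : W^T = W by rewrite /W !trmx_mul trmxK tr_diag_mx mulmxA.
have -> : \sum_i \sum_j invmx H i j * W i j = \tr (invmx H *m W).
  rewrite /mxtrace; apply: eq_bigr => i _; rewrite mxE; apply: eq_bigr => j _.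
  by rewrite -{1}WT [in LHS]mxE.
pose q : 'rV[R]_n := \row_k (e 0 k / d 0 k).
have Hu : H \in unitmx by rewrite !unitmx_mul unitmx_tr Lu Du.
have LTu : L^T \in unitmx by rewrite unitmx_tr.
have HW : H *m (invmx L^T *m diag_mx q *m L^T) = W.
  rewrite /H /W !mulmxA mulmxK// -(mulmxA L) mulmx_diag.
  by do 2![congr (_ *m _)]; congr diag_mx; apply/rowP => k; rewrite !mxE mulrC divfK.
rewrite -HW mulKmx// mxtrace_mulC mulmxA mulmxV// mul1mx mxtrace_diag.
by apply: eq_bigr => k _; rewrite mxE.
Qed.

Lemma tr_cofactor_congr_diag L d e : \det L = 1 -> (forall k, d 0 k != 0) ->
  \sum_i \sum_j cofactor (L *m diag_mx d *m L^T) i j * (L *m diag_mx e *m L^T) i j =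
  (\prod_k d 0 k) * \sum_k e 0 k / d 0 k.
Proof.
move=> L1 d0; rewrite -(tr_invmx_congr_diag _ L1 d0) -(det_congr_diag _ L1).
set H := L *m diag_mx d *m L^T.
have HT : H^T = H by rewrite /H !trmx_mul trmxK tr_diag_mx mulmxA.
have Hu : H \in unitmx.
  by rewrite unitmxE unitfE det_congr_diag//; apply/prodf_neq0 => k _.
have dH : \det H != 0 by rewrite -unitfE -unitmxE.
rewrite mulr_sumr; apply: eq_bigr => i _; rewrite mulr_sumr; apply: eq_bigr => j _.
rewrite mulrA; congr (_ * _).
by rewrite /invmx Hu mxE mulVKf// mxE -{1}HT cofactor_tr.
Qed.

End congruence_diagonal.

(** * Lengths of arcs and Lipschitz functions *)
Lemma cvg_sumr (R : realType) (T I : Type) (F : set_system T) (FF : Filter F)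
    (r : seq I) (P : pred I) (f : I -> T -> R) (a : I -> R) :
  (forall i, P i -> f i t @[t --> F] --> a i) ->
  (\sum_(i <- r | P i) f i t) @[t --> F] --> \sum_(i <- r | P i) a i.
Proof.
move=> fa; elim: r => [|i r IH].
  by under eq_cvg do rewrite big_nil; rewrite big_nil; exact: cvg_cst.
under eq_cvg do rewrite big_cons; rewrite big_cons.
by case: ifP => // Pi; apply: cvgD => //; exact: fa.
Qed.

Section quadratic_form.
Context (R : realType) (m : nat).
Implicit Types (A : 'M[R]_m) (v : 'rV[R]_m).

Lemma quad_formE A v : quad_form A v = \sum_i \sum_j v 0 j * A j i * v 0 i.
Proof.
rewrite /quad_form mxE; apply: eq_bigr => i _; rewrite !mxE mulr_suml.
by apply: eq_bigr => j _.
Qed.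

Lemma cvg_quad_form (T : Type) (F : set_system T) (FF : Filter F)
    (a : T -> 'M[R]_m) (v : T -> 'rV[R]_m) A (w : 'rV[R]_m) :
  (forall i j, a t i j @[t --> F] --> A i j) ->
  (forall i, v t 0 i @[t --> F] --> w 0 i) ->
  quad_form (a t) (v t) @[t --> F] --> quad_form A w.
Proof.
move=> aA vw; under eq_cvg do rewrite quad_formE.
rewrite quad_formE.
apply: cvg_sumr => i _.
apply: cvg_sumr => j _.
by apply: cvgM => //; apply: cvgM.
Qed.

End quadratic_form.

Lemma norm_le_sqrt (R : realType) (a b c : R) :
  0 <= c -> a ^+ 2 <= c ^+ 2 * b -> `|a| <= c * Num.sqrt b.
Proof.
move=> c0 ab; rewrite -(sqrtr_sqr a).
have -> : c = Num.sqrt (c ^+ 2) by rewrite sqrtr_sqr ger0_norm.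
by rewrite -sqrtrM ?sqr_ge0// ler_wsqrtr.
Qed.

Section arcs.
Context (R : realType) (m : nat) (M : set 'rV[R]_m) (g : 'rV[R]_m -> 'M[R]_m).
Hypothesis g_cts : forall x i j, M x -> {for x, continuous (fun y => g y i j)}.

Local Notation mu := (@lebesgue_measure R).

Lemma arc_continuous c (t : R) : C1_arc M c -> t \in `[0, 1] -> {for t, continuous c}.
Proof.
move=> [_ dc _] t01; apply/differentiable_continuous/derivable1_diffP.
exact: dc.
Qed.

Lemma velocity_within c (t : R) i : C1_arc M c -> `[0, 1]%classic t ->
  derive1 c s 0 i @[s --> within `[0, 1] (nbhs t)] --> derive1 c t 0 i.
Proof.
move=> [_ _ /subspace_continuousP cc] t01.
exact: (@cvg_comp _ _ _ (derive1 c) (fun v : 'rV[R]_m => v 0 i) _ _ _ (cc t t01)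
  (@coord_continuous _ _ _ 0 i _)).
Qed.

Lemma speed_within c : C1_arc M c ->
  {within `[0, 1], continuous (fun t => Num.sqrt (quad_form (g (c t)) (derive1 c t)))}.
Proof.
move=> Cc; apply/subspace_continuousP => t t01.
apply: continuous_cvg; first exact: sqrt_continuous.
apply: cvg_quad_form => [i j|i]; last exact: velocity_within.
apply: cvg_within_filter.
apply: (@continuous_comp _ _ _ c (fun y => g y i j)).
  exact: arc_continuous.
by apply: g_cts; have [+ _ _] := Cc; apply.
Qed.

Lemma speed_integrable c : C1_arc M c ->
  mu.-integrable `[0, 1]
    (EFin \o (fun t => Num.sqrt (quad_form (g (c t)) (derive1 c t)))).
Proof.
move=> Cc; apply: continuous_compact_integrable; first exact: segment_compact.
exact: speed_within.
Qed.

Lemma arc_length_ge0 c : 0 <= arc_length g c.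
Proof. by apply: Rintegral_ge0 => t _; exact: sqrtr_ge0. Qed.

Lemma arc_length_le c B : C1_arc M c ->
  (forall t, t \in `[0, 1] -> Num.sqrt (quad_form (g (c t)) (derive1 c t)) <= B) ->
  arc_length g c <= B.
Proof.
move=> Cc cB; apply: le_trans (_ : \int[mu]_(t in `[0, 1]) B <= _).
  apply: le_Rintegral => //; first exact: speed_integrable.
  apply: continuous_compact_integrable; first exact: segment_compact.
  by apply: continuous_subspaceT => t; exact: cvg_cst.
rewrite Rintegral_cst//= lebesgue_measure_itv/= lte_fin ltr01.
by rewrite -EFinD /= subr0 mulr1.
Qed.

(** The increment of [h] along the arc is the integral of [dh] on the velocity, which
is pointwise at most [C] times the speed.  Continuity of the integrand comes from its
expansion on the canonical basis, whose coefficients are continuous on [M]. *)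
Lemma lipschitz_arc h dh C c : elementary M h dh ->
  (forall x v, M x -> `|dh x v| <= C * Num.sqrt (quad_form (g x) v)) ->
  C1_arc M c -> `|h (c 1) - h (c 0)| <= C * arc_length g c.
Proof.
move=> hdh dhC Cc; have [cM dc _] := Cc.
pose psi t := dh (c t) (derive1 c t).
have dphi t : t \in `[0, 1] ->
    derivable (h \o c) t 1 /\ derive1 (h \o c) t = psi t.
  move=> t01; have [dh1 dh2] := elementary_diff hdh (cM t t01).
  have dct : differentiable c t by apply/derivable1_diffP/dc.
  have dhc : differentiable (h \o c) t by exact: differentiable_comp.
  split; first exact/derivable1_diffP.
  by rewrite derive1E' // (diff_comp dct dh1) /= dh2 -derive1E'.
have psi_within : {within `[0, 1], continuous psi}.
  apply/subspace_continuousP => t t01.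
  have psiE s : `[0, 1]%classic s ->
      psi s = \sum_i derive1 c s 0 i * dh (c s) (delta_mx 0 i).
    by move=> s01; exact: elementary_sum_delta hdh (cM s s01).
  rewrite /from_subspace psiE//.
  have : (fun s => \sum_i derive1 c s 0 i * dh (c s) (delta_mx 0 i))
    @ within `[0, 1] (nbhs t) --> \sum_i derive1 c t 0 i * dh (c t) (delta_mx 0 i).
    apply: cvg_sumr => i _.
    apply: cvgM; first exact: velocity_within.
    apply: cvg_within_filter.
    have [ddh ddhE] := elementary_differential (delta_mx 0 i) hdh.
    apply: (@continuous_comp _ _ _ c (fun y => dh y (delta_mx 0 i))).
      exact: arc_continuous.
    exact: elementary_continuous ddhE (cM t t01).
  apply: cvg_trans; apply: fmap_within_eq => s s01.
  by rewrite psiE// -inE.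
have ipsi : mu.-integrable `[0, 1] (EFin \o psi).
  by apply: continuous_compact_integrable => //; exact: segment_compact.
have -> : h (c 1) - h (c 0) = \int[mu]_(t in `[0, 1]) psi t.
  rewrite /Rintegral (@continuous_FTC2 _ _ (h \o c))//.
    split.
    - by move=> t /subset_itv_oo_cc /dphi[].
    - apply: cvg_at_right_filter; apply: differentiable_continuous.
      by apply/derivable1_diffP; apply: (dphi 0 _).1; rewrite in_itv /= lexx ler01.
    - apply: cvg_at_left_filter; apply: differentiable_continuous.
      by apply/derivable1_diffP; apply: (dphi 1 _).1; rewrite in_itv /= lexx ler01.
  by move=> t /subset_itv_oo_cc /dphi[].
apply: le_trans (le_normr_Rintegral _ ipsi) _ => //.
rewrite /arc_length -RintegralZl//; last exact: speed_integrable.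
apply: le_Rintegral => //.
- apply: continuous_compact_integrable; first exact: segment_compact.
  apply/subspace_continuousP => t t01; apply: cvg_norm.
  by move/subspace_continuousP : psi_within; apply.
- apply: continuous_compact_integrable; first exact: segment_compact.
  apply/subspace_continuousP => t t01; apply: cvgMr.
  by move/subspace_continuousP : (speed_within Cc); apply.
- by move=> t t01; apply: dhC; exact: cM.
Qed.

End arcs.

(** * The Riemannian distance *)
Lemma cvg_rV (R : realType) (n : nat) (T : Type) (F : set_system T)
    (FF : Filter F) (f : T -> 'rV[R]_n) (l : 'rV[R]_n) :
  (forall i, f t 0 i @[t --> F] --> l 0 i) -> f t @[t --> F] --> l.
Proof.
move=> fl; apply/cvgrPdist_lt => e e0; near=> y.
rewrite /Num.norm /= mx_normrE; apply/bigmax_ltP; split => // -[i' j'] _.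
rewrite !mxE /= (ord1 i'); move: j'; near: y; apply: filter_forall => j'.
by have /cvgrPdist_lt := fl j'; exact.
Unshelve. all: by end_near. Qed.

Definition riem_cauchy (R : realType) (m : nat) (M : set 'rV[R]_m)
    (g : 'rV[R]_m -> 'M[R]_m) (u : nat -> 'rV[R]_m) : Prop :=
  forall e : R, 0 < e -> exists N : nat, forall p q : nat,
    (N <= p)%N -> (N <= q)%N -> (riem_dist M g (u p) (u q) < e%:E)%E.

Section distance.
Context (R : realType) (m : nat) (M : set 'rV[R]_m) (g : 'rV[R]_m -> 'M[R]_m).
Hypothesis g_cts : forall x i j, M x -> {for x, continuous (fun y => g y i j)}.

Lemma riem_dist_ge0 x y : (0 <= riem_dist M g x y)%E.
Proof.
apply: le_ereal_inf_tmp => _ [s _ <-]; rewrite lee_fin.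
by apply: sumr_ge0 => c _; exact: arc_length_ge0.
Qed.

Lemma riem_dist_le_arc c : C1_arc M c ->
  (riem_dist M g (c 0%R) (c 1%R) <= (arc_length g c)%:E)%E.
Proof.
move=> Cc; apply: ereal_inf_lbound; exists [:: c]; first by [].
by rewrite big_seq1.
Qed.

Section lipschitz.
Variables (h : 'rV[R]_m -> R) (dh : 'rV[R]_m -> 'rV[R]_m -> R) (C : R).
Hypotheses (C0 : 0 <= C) (hdh : elementary M h dh).
Hypothesis dhC :
  forall x v, M x -> `|dh x v| <= C * Num.sqrt (quad_form (g x) v).

Lemma lipschitz_chain s x y : C1_chain M x s y ->
  `|h y - h x| <= C * \sum_(c <- s) arc_length g c.
Proof.
elim: s x => [|c s IH] x /=; first by move=> ->; rewrite big_nil subrr normr0 mulr0.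
move=> [Cc <- cs]; rewrite big_cons mulrDr [leRHS]addrC -(subrKA (h (c 1))).
apply: le_trans (ler_normD _ _) _; apply: lerD; first exact: IH.
exact: lipschitz_arc hdh dhC Cc.
Qed.

Lemma lipschitz_riem_dist x y (e : R) :
  (riem_dist M g x y < e%:E)%E -> `|h y - h x| <= C * e.
Proof.
move=> /ereal_inf_lt[_ [s sxy <-]]; rewrite lte_fin => /ltW se.
exact: le_trans (lipschitz_chain sxy) (ler_wpM2l C0 se).
Qed.

(** A Lipschitz function turns a Cauchy sequence of the Riemannian distance into a
Cauchy sequence of real numbers: this is how limits of coordinates are obtained. *)
Lemma lipschitz_cauchy_cvg u : riem_cauchy M g u ->
  exists l : R, h (u k) @[k --> \oo] --> l.
Proof.
move=> uC; suff /cauchy_cvgP/cvg_ex[l hl] : cauchy (h (u k) @[k --> \oo]).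
  by exists l.
apply: cauchy_exP => e e0.
have Ce : 0 < e / (C + 1) by rewrite divr_gt0// ltr_wpDl.
have [N uN] := uC _ Ce.
exists (h (u N)); exists N => // k /= Nk.
rewrite -ball_normE /= distrC.
apply: le_lt_trans (lipschitz_riem_dist (uN _ _ (leqnn N) Nk)) _.
by rewrite mulrCA gtr_pMr// ltr_pdivrMr ?mul1r ?ltrDl// ltr_wpDl.
Qed.

End lipschitz.
End distance.

Section pushforward.
Context (R : realType) (n m : nat) (Omega : set 'rV[R]_n) (M : set 'rV[R]_m).
Variables (g : 'rV[R]_m -> 'M[R]_m) (Phi : 'rV[R]_n -> 'rV[R]_m).
Variable (dPhi : 'I_m -> 'rV[R]_n -> 'rV[R]_n -> R).
Hypothesis g_cts : forall x i j, M x -> {for x, continuous (fun y => g y i j)}.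
Hypothesis oOmega : open Omega.
Hypothesis PhiM : forall x, Omega x -> M (Phi x).
Hypothesis PhidPhi : forall j, elementary Omega (fun x => Phi x 0 j) (dPhi j).

Let J x : 'M[R]_(n, m) := \matrix_(i, j) dPhi j x (delta_mx 0 i).
(** The metric pulled back by [Phi]; [J x] acts on row vectors. *)
Let G x : 'M[R]_n := J x *m g (Phi x) *m (J x)^T.

Let dPhiE j x v : Omega x -> dPhi j x v = (v *m J x) 0 j.
Proof.
move=> Ox; rewrite mxE (elementary_sum_delta v (PhidPhi j) Ox).
by apply: eq_bigr => i _; rewrite mxE.
Qed.

Lemma pull_metric_continuous x i j : Omega x -> {for x, continuous (fun y => G y i j)}.
Proof.
move=> Ox.
have JE k l : (fun y => J y k l) y @[y --> x] --> J x k l.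
  rewrite mxE; under eq_cvg do rewrite mxE.
  have [ddP ddPE] := elementary_differential (delta_mx 0 k) (PhidPhi l).
  exact: (elementary_continuous ddPE Ox).
have gE k l : g (Phi y) k l @[y --> x] --> g (Phi x) k l.
  apply: (@continuous_comp _ _ _ Phi (fun y => g y k l)); last exact/g_cts/PhiM.
  apply: (@cvg_rV _ _ _ (nbhs x) (nbhs_filter x)) => l'.
  exact: elementary_continuous (PhidPhi l') Ox.
have GE y : G y i j = \sum_k (\sum_l J y i l * g (Phi y) l k) * J y j k.
  rewrite mxE; apply: eq_bigr => k _; rewrite [X in _ * X]mxE; congr (_ * _).
  by rewrite mxE.
rewrite (funext GE : (fun y => G y i j) = _).
rewrite /prop_for /continuous_at.
apply: (@cvg_sumr _ _ _ (nbhs x) (nbhs_filter x)) => k _; apply: cvgM => //.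
by apply: (@cvg_sumr _ _ _ (nbhs x) (nbhs_filter x)) => l _; apply: cvgM.
Qed.

Lemma segment_arc x y : (forall t : R, t \in `[0, 1] -> Omega (t *: (x - y) + y)) ->
  C1_arc M (fun t => Phi (t *: (x - y) + y)) /\
  forall t : R, t \in `[0, 1] ->
    derive1 (fun t => Phi (t *: (x - y) + y)) t = (x - y) *m J (t *: (x - y) + y).
Proof.
set p := fun t : R => t *: (x - y) + y; move=> pO.
pose q (t : R) := Phi (p t).
have dPhip t : t \in `[0, 1] -> derivable q t (1 : R).
  move=> t01; apply/derivable_mxP => i j; rewrite (ord1 i).
  by have [] := elementary_derive_line (PhidPhi j) (pO t t01).
have PhipE t : t \in `[0, 1] -> derive1 q t = (x - y) *m J (p t).
  move=> t01; rewrite derive1E derive_mx; last exact: dPhip.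
  apply/rowP => j; rewrite mxE -dPhiE; last exact: pO.
  by have [] := elementary_derive_line (PhidPhi j) (pO t t01).
split; last exact: PhipE.
split; [by move=> t /pO/PhiM | exact: dPhip |].
apply: (@subspace_eq_continuous _ _ _ (fun t => (\row_j dPhi j (p t) (x - y)))).
  move=> t; rewrite inE => t01; rewrite -[RHS]/(derive1 q t) PhipE//.
  by apply/rowP => j; rewrite mxE dPhiE//; exact: pO.
apply: derivable_within_continuous => t t01.
apply/derivable_mxP => i j.
have [ddP ddPE] := elementary_differential (x - y) (PhidPhi j).
under [X in derivable X]eq_fun do rewrite mxE.
by have [] := elementary_derive_line ddPE (pO t t01).
Qed.

(** The segment from [y k] to [x] is carried by [Phi] to an arc whose length is at most
a constant times the norm of [x - y k], as the pulled back metric is bounded near [x].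
It serves for the Calabi metric with [Phi] the identity, and for a graph with [Phi] its
parametrization. *)
Lemma riem_dist_cvg0 (y : nat -> 'rV[R]_n) x : Omega x ->
  y k @[k --> \oo] --> x ->
  riem_dist M g (Phi (y k)) (Phi x) @[k --> \oo] --> 0%E.
Proof.
move=> Ox yx.
(* The quadratic form [G z] is at most [S z] times the squared sup norm. *)
pose S z := \sum_i \sum_j `|G z j i|.
have cS : S z @[z --> x] --> S x.
  apply: (@cvg_sumr _ _ _ (nbhs x) (nbhs_filter x)) => i _.
  apply: (@cvg_sumr _ _ _ (nbhs x) (nbhs_filter x)) => j _; apply: cvg_norm.
  exact: pull_metric_continuous.
have [r /= r0 xr] : exists2 r, 0 < r & forall z, ball x r z -> Omega z /\ S z < S x + 1.
  have : \forall z \near x, Omega z /\ S z < S x + 1.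
    near=> z; split; first by near: z; exact: open_nbhs_nbhs.
    near: z; apply: (cvgr_lt _ cS); by rewrite ltrDl.
  by move=> /nbhs_ballP[r r0 rx]; exists r.
have S0 z : 0 <= S z by do 2![apply: sumr_ge0 => ? _].
apply: (@squeeze_cvge _ _ _ _ (fun=> 0%E) _
  (fun k => (Num.sqrt (S x + 1) * `|x - y k|)%:E)).
- near=> k; rewrite riem_dist_ge0/=.
  have xy : ball x r (y k) by near: k; apply: yx; exact: nbhsx_ballx.
  have pO (t : R) : t \in `[0, 1] -> ball x r (t *: (x - y k) + y k).
    rewrite in_itv /= => /andP[t0 t1]; move: xy; rewrite -!ball_normE /=.
    apply: le_lt_trans.
    have -> : x - (t *: (x - y k) + y k) = (1 - t) *: (x - y k).
      by rewrite scalerBl scale1r opprD addrCA addrC -addrA.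
    by rewrite normrZ ger0_norm ?subr_ge0// ler_piMl// gerBl.
  have [Cc cE] := @segment_arc x (y k) (fun t t01 => (xr _ (pO t t01)).1).
  have := @riem_dist_le_arc _ _ M g _ Cc; rewrite scale1r scale0r add0r subrK.
  move=> /le_trans; apply; rewrite lee_fin; apply: (arc_length_le g_cts Cc) => t t01.
  rewrite cE//; set v := x - y k; set z := _ + y k.
  have -> : quad_form (g (Phi z)) (v *m J z) = quad_form (G z) v.
    by rewrite /quad_form /G trmx_mul !mulmxA.
  have -> : `|v| = Num.sqrt (`|v| ^+ 2) by rewrite sqrtr_sqr normr_id.
  rewrite -sqrtrM ?addr_ge0//; apply: ler_wsqrtr.
  apply: (@le_trans _ _ (S z * `|v| ^+ 2)); last first.
    by rewrite ler_wpM2r ?sqr_ge0// ltW//; exact: (xr _ (pO t t01)).2.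
  have vi i : `|v 0 i| <= `|v|.
    by rewrite [leRHS]/Num.norm /= mx_normrE; exact: (le_bigmax _ _ (0, i)).
  rewrite quad_formE /S mulr_suml; apply: ler_sum => i _.
  rewrite mulr_suml; apply: ler_sum => j _.
  apply: le_trans (ler_norm _) _; rewrite !normrM mulrAC mulrC.
  by rewrite ler_wpM2l// expr2 ler_pM.
- exact: cvg_cst.
- apply: cvg_EFin; first by near=> k.
  rewrite -[X in _ --> X](mulr0 (Num.sqrt (S x + 1))); apply: cvgM; first exact: cvg_cst.
  rewrite -(normr0 'rV[R]_n); apply: cvg_norm; rewrite -(subrr x).
  by apply: cvgB => //; exact: cvg_cst.
Unshelve. all: by end_near. Qed.

End pushforward.

(** * The common family of potentials and its Hessian *)
Section model.
Context (R : realType) (n : nat) (i1 : 'I_n) (r s : R).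
Implicit Types (x v w : 'rV[R]_n).

Definition height x : R := x 0 i1 - r * \sum_(k < n | k != i1) x 0 k ^+ 2 / 2.

Definition dheight x v : R :=
  v 0 i1 - r * \sum_(k < n | k != i1) x 0 k * v 0 k.

Definition height_domain : set 'rV[R]_n := [set x | 0 < height x].

Definition potential x : R :=
  - (1 / 4) * ln (height x)
  + s * \sum_(k < n | k != i1) x 0 k ^+ 2 / (2 * height x).

Definition dpotential x v : R :=
  - (1 / 4) * ((height x)^-1 * dheight x v)
  + s * \sum_(k < n | k != i1)
      (x 0 k * v 0 k * (height x)^-1
       - x 0 k ^+ 2 / 2 * (height x)^-1 ^+ 2 * dheight x v).

(** The coframe [du], [omega_k] that diagonalizes the Hessian, with [du] at the index
[i1]. *)
Definition coframe x v k : R :=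
  if k == i1 then dheight x v
  else v 0 k - s * x 0 k * (height x)^-1 * dheight x v.

(** The diagonal coefficients of the Hessian in the coframe. *)
Definition weight x : 'rV[R]_n :=
  \row_k if k == i1 then (height x)^-1 ^+ 2 / 4 else (r / 4 + s) * (height x)^-1.

(** Vectors are rows: the coframe is the multiplication by [frame x] on the right. *)
Definition frame x : 'M[R]_n := \matrix_(i, k) coframe x (delta_mx 0 i) k.

Local Notation Omega := height_domain.

Lemma height_elementary M : elementary M height dheight.
Proof.
have sqr k : elementary M (fun x => x 0 k ^+ 2 / 2) _ :=
  elementaryM (elementaryX 2 (elementary_coord M k)) (elementary_cst M 2^-1).
have sum := elementary_sum (index_enum 'I_n) (P := fun k => k != i1) (fun k _ => sqr k).
apply: elementary_ext
  (elementaryB (elementary_coord M i1) (elementaryM (elementary_cst M r) sum)) _ _.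
- by [].
- move=> x v /=; rewrite mulr0 addr0; congr (_ - _ * _).
  by apply: eq_bigr => k _; rewrite mulr0 add0r expr1; field.
Qed.

Lemma dheight_elementary M v : elementary M (dheight^~ v)
  (fun _ w => - (r * \sum_(k < n | k != i1) w 0 k * v 0 k)).
Proof.
have mul k : elementary M (fun x => x 0 k * v 0 k) _ :=
  elementaryM (elementary_coord M k) (elementary_cst M (v 0 k)).
have sum := elementary_sum (index_enum 'I_n) (P := fun k => k != i1) (fun k _ => mul k).
apply: elementary_ext
  (elementaryB (elementary_cst M (v 0 i1)) (elementaryM (elementary_cst M r) sum)) _ _.
- by [].
- move=> x w /=; rewrite mulr0 addr0 sub0r; congr (- (_ * _)).
  by apply: eq_bigr => k _; ring.
Qed.

Lemma heightV_elementary : elementary Omega (fun x => (height x)^-1)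
  (fun x v => - ((height x)^-1 * (height x)^-1) * dheight x v).
Proof.
by apply: elementaryV; [exact: height_elementary | move=> x /lt0r_neq0].
Qed.

Lemma potential_elementary : elementary Omega potential dpotential.
Proof.
have sqr k : elementary Omega (fun x => x 0 k ^+ 2 / 2) _ :=
  elementaryM (elementaryX 2 (elementary_coord _ k)) (elementary_cst _ 2^-1).
have sum := elementary_sum (index_enum 'I_n) (P := fun k => k != i1)
  (fun k _ => elementaryM (sqr k) heightV_elementary).
have ln_height := elementary_ln (height_elementary Omega) (fun x Ox => Ox).
apply: elementary_ext
  (elementaryD (elementaryM (elementary_cst _ (- (1 / 4))) ln_height)
               (elementaryM (elementary_cst _ s) sum)) _ _.
- move=> x /=; congr (_ + _ * _).
  by apply: eq_bigr => k _; rewrite invfM mulrA.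
- move=> x v /=; rewrite !mulr0 !addr0; congr (_ + _ * _).
  apply: eq_bigr => k _; rewrite expr1; set q := (height x)^-1.
  by rewrite expr2; field.
Qed.

Hypothesis rs : (r = 1 /\ s = 0) \/ (r = 0 /\ s = 1).

(** Each term [x_k^2 / (2 u)] has the rank one Hessian [omega_k^2 / u], up to a term in
the second derivative of [u] that disappears as [r s = 0]; the Hessian of
[- (1/4) ln u] contributes [du^2 / (4 u^2)] and [r / (4 u)] times the sum of the
[dx_k^2]. *)
Lemma dpotential_elementary v : elementary Omega (dpotential^~ v)
  (fun x w => \sum_k weight x 0 k * coframe x w k * coframe x v k).
Proof.
have crd k := elementary_coord Omega k.
have sum := elementary_sum (index_enum 'I_n) (P := fun k => k != i1) (fun k _ =>
  elementaryB
    (elementaryM (elementaryM (crd k) (elementary_cst Omega (v 0 k))) heightV_elementary)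
    (elementaryM
      (elementaryM (elementaryM (elementaryX 2 (crd k)) (elementary_cst Omega 2^-1))
                   (elementaryX 2 heightV_elementary))
      (dheight_elementary Omega v))).
apply: elementary_ext
  (elementaryD
    (elementaryM (elementary_cst Omega (- (1 / 4)))
      (elementaryM heightV_elementary (dheight_elementary Omega v)))
    (elementaryM (elementary_cst Omega s) sum)) _ _.
- by [].
- move=> x w /=; rewrite [RHS](bigD1 i1)//= /coframe eqxx mxE eqxx.
  set q := (height x)^-1; set S := \sum_(k < n | _) w 0 k * v 0 k.
  rewrite !mulr0 !addr0.
  have -> : \sum_(i < n | i != i1) weight x 0 i *
      (if i == i1 then dheight x w else w 0 i - s * x 0 i * q * dheight x w) *
      (if i == i1 then dheight x v else v 0 i - s * x 0 i * q * dheight x v) =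
     r / 4 * q * S + s * \sum_(i < n | i != i1)
       q * (w 0 i - x 0 i * q * dheight x w) * (v 0 i - x 0 i * q * dheight x v).
    rewrite !mulr_sumr -big_split /=; apply: eq_bigr => k /negbTE k1.
    by rewrite mxE k1 -/q; case: rs => -[-> ->]; field.
  rewrite (_ : s * \sum_(k < n | _) _ = s * \sum_(i < n | i != i1)
       q * (w 0 i - x 0 i * q * dheight x w) * (v 0 i - x 0 i * q * dheight x v)).
    by field.
  case: rs => -[rE sE]; first by rewrite sE !mul0r.
  by congr (_ * _); apply: eq_bigr => k _; rewrite rE !expr1 /=; field.
Qed.


Lemma height_domain_open : open Omega.
Proof.
apply: (open_comp (f := height) (D := [set a | 0 < a])); last exact: open_gt.
by move=> x _; exact: (elementary_continuous (height_elementary setT)).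
Qed.

Lemma hessian_potential x : Omega x ->
  hessian potential x = frame x *m diag_mx (weight x) *m (frame x)^T.
Proof.
move=> Ox; apply/matrixP => i j; rewrite congr_diagE.
rewrite (hessian_elementary height_domain_open _ potential_elementary
  (dpotential_elementary (delta_mx 0 j)))//.
by apply: eq_bigr => k _; rewrite [frame x i k]mxE [frame x j k]mxE.
Qed.

Lemma mul_frame x v k : (v *m frame x) 0 k = coframe x v k.
Proof.
rewrite mxE; under eq_bigr do rewrite [X in _ * X]mxE.
rewrite /coframe; case: ifP => k1.
  by rewrite -(elementary_sum_delta v (height_elementary setT) I).
have h := elementaryB (elementary_coord setT k)
  (elementaryM (elementary_cst setT (s * x 0 k * (height x)^-1))
               (height_elementary setT)).
have := @elementary_sum_delta _ _ _ _ _ x v h I.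
rewrite mulr0 addr0 => ->; apply: eq_bigr => i _.
by rewrite addr0.
Qed.

Lemma quad_form_hessian x v : Omega x ->
  quad_form (hessian potential x) v = \sum_k weight x 0 k * coframe x v k ^+ 2.
Proof.
move=> Ox; rewrite hessian_potential// quad_form_congr_diag.
by apply: eq_bigr => k _; rewrite mul_frame.
Qed.

Let scale_ge : 4^-1 <= r / 4 + s.
Proof. by case: rs => -[-> ->]; lra. Qed.

Lemma weight_gt0 x k : Omega x -> 0 < weight x 0 k.
Proof.
move=> Ox; rewrite mxE; have q0 : 0 < (height x)^-1 by rewrite invr_gt0.
case: ifP => _; first by rewrite divr_gt0// exprn_gt0.
by rewrite mulr_gt0//; apply: lt_le_trans scale_ge; rewrite invr_gt0.
Qed.

(** The domain is a superlevel set of [height], which is concave as [r >= 0]. *)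
Lemma convex_height_domain : convex_set Omega.
Proof.
move=> x y t; rewrite !inE /height_domain /= => x0 y0.
have [t0 t1] : 0 <= t%:num /\ t%:num <= 1 by [].
pose l := t%:num.
have r0 : 0 <= r by case: rs => -[->].
suff : l * height x + (1 - l) * height y <= height (l *: x + (1 - l) *: y).
  by apply: lt_le_trans; have := convR_gt0 t x0 y0.
rewrite /height !mxE !mulrBr addrACA -opprD lerB//.
rewrite ![l * _]mulrCA ![(1 - l) * _]mulrCA -mulrDr ler_wpM2l//.
rewrite !mulr_sumr -big_split /=; apply: ler_sum => k _; rewrite !mxE.
(* This product is the convexity defect of the square. *)
have : 0 <= l * (1 - l) * (x 0 k - y 0 k) ^+ 2.
  by apply: mulr_ge0; [apply: mulr_ge0; rewrite ?subr_ge0 | exact: sqr_ge0].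
rewrite /l; nra.
Qed.

Hypothesis i10 : i1 = 0%N :> nat.

Lemma height_delta : height (delta_mx 0 i1) = 1.
Proof.
rewrite /height mxE !eqxx big1 ?mulr0 ?subr0// => k /negbTE k1.
by rewrite mxE k1 andbF expr0n mul0r.
Qed.

Lemma dheight_delta x i :
  dheight x (delta_mx 0 i) = if i == i1 then 1 else - (r * x 0 i).
Proof.
rewrite /dheight mxE eqxx /= eq_sym; case: eqVneq => [->|ii1].
  rewrite big1 ?mulr0 ?subr0// => k /negbTE k1.
  by rewrite mxE k1 andbF mulr0.
rewrite (bigD1 i)//= big1 => [|k /andP[_ /negbTE ki]].
  by rewrite mxE !eqxx mulr1 addr0 sub0r.
by rewrite mxE ki andbF mulr0.
Qed.

Lemma frameE x i k : frame x i k = coframe x (delta_mx 0 i) k.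
Proof. by rewrite mxE. Qed.

(** The only off-diagonal entries are in the column of [i1] if [s = 0], and in its row if
[r = 0]; as [i1] is the first index, [frame x] or its transpose is lower triangular. *)
Lemma det_frame x : \det (frame x) = 1.
Proof.
have diag i : frame x i i = 1.
  rewrite frameE /coframe dheight_delta mxE !eqxx; case: eqVneq => // _.
  by case: rs => -[-> ->]; rewrite /=; ring.
have lt_i1 (i k : 'I_n) : (i < k)%N -> (k == i1) = false.
  by move=> ik; apply/negP => /eqP ki; rewrite ki i10 in ik.
case: rs => -[rE sE].
- rewrite det_trig; first by rewrite big1.
  apply/is_trig_mxP => i k ik; rewrite frameE /coframe (lt_i1 i k ik) sE mxE.
  by rewrite eqxx -val_eqE /= (gtn_eqF ik) !mul0r subr0.
- rewrite -det_tr det_trig; first by rewrite big1// => i _; rewrite mxE.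
  apply/is_trig_mxP => k i ki; rewrite mxE frameE /coframe dheight_delta rE.
  rewrite (lt_i1 k i ki) mul0r oppr0 mulr0 subr0; case: ifP => // _.
  by rewrite mxE eqxx -val_eqE /= (ltn_eqF ki).
Qed.

Lemma potential_strictly_convex : smooth_strictly_convex Omega potential.
Proof.
split.
- split; [exact: height_domain_open| |exact: convex_height_domain].
  by exists (delta_mx 0 i1); rewrite /height_domain /= height_delta.
- exact: (elementary_smooth height_domain_open potential_elementary).
- move=> x Ox v v0; rewrite hessian_potential//.
  apply: quad_form_congr_diag_gt0 => //; first by rewrite unitmxE det_frame unitr1.
  by move=> k; exact: weight_gt0.
Qed.

Let scale := r / 4 + s.
Let kappa := scale ^+ n.-1 / 4.

Let scale_gt0 : 0 < scale.
Proof. by apply: lt_le_trans scale_ge; rewrite invr_gt0. Qed.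

Let kappa_gt0 : 0 < kappa.
Proof. by rewrite divr_gt0// exprn_gt0. Qed.

Lemma prod_weight x : \prod_k weight x 0 k = kappa * (height x)^-1 ^+ n.+1.
Proof.
have n0 : (0 < n)%N by exact: leq_ltn_trans (ltn_ord i1).
rewrite (bigD1 i1)//= mxE eqxx.
rewrite (eq_bigr (fun=> scale * (height x)^-1)); last first.
  by move=> k /negbTE k1; rewrite mxE k1.
rewrite prodr_const (_ : #|_| = n.-1); last first.
  by rewrite -[n in RHS]card_ord (cardC1 i1).
rewrite exprMn /kappa (_ : n.+1 = (2 + n.-1)%N); last by rewrite add2n prednK.
by set q := (height x)^-1; rewrite exprD; field.
Qed.

Lemma det_hess_potential x (a : R) p : Omega x -> a * n.+1%:R = - p%:R ->
  det_hess_pow a potential x = kappa `^ a * height x ^+ p.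
Proof.
move=> Ox aE; have u0 : 0 <= height x by exact: ltW.
rewrite /det_hess_pow hessian_potential// det_congr_diag ?det_frame// prod_weight.
rewrite powRM ?exprn_ge0 ?invr_ge0 1?ltW//; congr (_ * _).
rewrite exprVn -powR_invn// -powRrM mulNr mulrC aE opprK.
by rewrite powR_mulrn.
Qed.

(** The diagonal coefficients, in the coframe, of the Hessian of [K u^p].  The truncated
predecessors are harmless: they only occur next to a factor that vanishes with them. *)
Definition height_power_weight (K : R) p x : 'rV[R]_n :=
  \row_k if k == i1 then K * (p%:R * p.-1%:R * height x ^+ p.-2)
         else - (K * (p%:R * r * height x ^+ p.-1)).

(** The second derivative of [u] is [- r] times the sum of the [dx_k^2], which is also
the sum of the [- r omega_k^2] because [r s = 0]: the coframe of the potential serves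
again. *)
Lemma hessian_height_power (K : R) p x : Omega x ->
  hessian (fun x => K * height x ^+ p) x =
  frame x *m diag_mx (height_power_weight K p x) *m (frame x)^T.
Proof.
move=> Ox; apply/matrixP => i j; rewrite congr_diagE.
have uE := height_elementary Omega.
have fE := elementaryM (elementary_cst Omega K) (elementaryX p uE).
have dfE := elementaryD
  (elementaryM (elementary_cst Omega K) (elementaryM
    (elementaryM (elementary_cst Omega p%:R) (elementaryX p.-1 uE))
    (dheight_elementary Omega (delta_mx 0 j))))
  (elementaryM (elementaryX p uE) (elementary_cst Omega 0)).
rewrite (hessian_elementary height_domain_open _ fE dfE)//=.
rewrite [RHS](bigD1 i1)//= !frameE /coframe eqxx mxE eqxx.
set S := \sum_(k < n | _) _ * _.
rewrite (_ : \sum_(k < n | k != i1) _ * _ * _ = - (K * (p%:R * r * height x ^+ p.-1)) * S).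
  by ring.
rewrite mulr_sumr; apply: eq_bigr => k /negbTE k1.
rewrite mxE k1 !frameE /coframe k1.
by case: rs => -[-> ->]; ring.
Qed.

Lemma sum_weight_ratio (K : R) p x : Omega x ->
  \sum_k height_power_weight K p.+1 x 0 k / weight x 0 k =
  4 * K * p.+1%:R * (p%:R - r * n.-1%:R) * height x ^+ p.+1.
Proof.
move=> Ox; have u0 : height x != 0 by exact: lt0r_neq0.
rewrite (bigD1 i1)//= !mxE eqxx.
rewrite (eq_bigr (fun=> - (4 * K * p.+1%:R * r * height x ^+ p.+1))); last first.
  move=> k /negbTE k1; rewrite !mxE k1 exprS.
  by case: rs => -[-> ->]; field.
rewrite sumr_const (_ : #|_| = n.-1); last first.
  by rewrite -[n in RHS]card_ord (cardC1 i1).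
rewrite -mulr_natr; case: p => [|p] /=.
  by rewrite mulr0 mul0r mulr0 mul0r; ring.
by rewrite !exprS; field.
Qed.

(** The hypothesis on [a] says that [det^a] is a multiple of [u^(p+1)], and the one on
[p] that the contraction of its Hessian vanishes. *)
Lemma affine_maximal_potential (a : R) p : a != 0 ->
  a * n.+1%:R = - p.+1%:R -> p%:R = r * n.-1%:R ->
  affine_maximal_type a Omega potential.
Proof.
move=> a0 aE pE; split=> //; first exact: potential_strictly_convex.
move=> x Ox.
rewrite (hessian_eq_on height_domain_open (f := det_hess_pow a potential)
  (g := fun x => kappa `^ a * height x ^+ p.+1))//.
  rewrite hessian_potential// hessian_height_power//.
  rewrite tr_invmx_congr_diag ?det_frame//; last by move=> k; rewrite gt_eqF// weight_gt0.
  by rewrite sum_weight_ratio// pE subrr mulr0 mul0r.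
by move=> y Oy; exact: det_hess_potential.
Qed.

Lemma abreu_potential (L : R) :
  L = - (4 * n.+1%:R * (n%:R - r * n.-1%:R)) -> abreu Omega potential L.
Proof.
move=> ->; split; first exact: potential_strictly_convex.
move=> x Ox.
rewrite (hessian_eq_on height_domain_open (f := det_hess_pow (-1) potential)
  (g := fun x => kappa `^ (-1) * height x ^+ n.+1))//.
  rewrite hessian_potential// hessian_height_power//.
  rewrite tr_cofactor_congr_diag ?det_frame//; last by move=> k; rewrite gt_eqF// weight_gt0.
  rewrite sum_weight_ratio// prod_weight powR_inv1; last exact: ltW.
  rewrite exprVn; field.
  by rewrite expf_neq0 ?gt_eqF.
by move=> y Oy; apply: det_hess_potential; rewrite ?mulN1r.
Qed.

End model.

(** * Euclidean completeness of graphs that blow up at the boundary *)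
Section euclidean.
Context (R : realType) (n : nat) (Omega : set 'rV[R]_n) (f : 'rV[R]_n -> R).
Variables (df : 'rV[R]_n -> 'rV[R]_n -> R) (u : 'rV[R]_n -> R).

(** The ambient coordinates of a Cauchy sequence converge.  The heights [f (y k)] being
bounded, the lower bound on [u] keeps the limit of [y k] inside the domain, where the
segments to the limit can be lifted to the graph. *)
Lemma euclidean_complete_blowup (c : R) : open Omega -> elementary Omega f df ->
  continuous u -> Omega = [set x | 0 < u x] ->
  (forall x, Omega x -> expR (c * f x) <= u x) -> euclidean_complete Omega f.
Proof.
move=> oO fdf uc OE fu U UM UC.
have g_cts (x : 'rV[R]_(n + 1)) (i j : 'I_(n + 1)) : graph_of Omega f x ->
    {for x, continuous (fun y : 'rV[R]_(n + 1) => (1%:M : 'M[R]_(n + 1)) i j)}.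
  by move=> _; apply: cst_continuous.
have coord j : exists l : R, U k 0 j @[k --> \oo] --> l.
  apply: (lipschitz_cauchy_cvg g_cts ler01 (elementary_coord _ j) _ UC) => x v _.
    rewrite mul1r -sqrtr_sqr; apply: ler_wsqrtr.
    rewrite /quad_form mulmx1 mxE (bigD1 j)//= [X in _ * X]mxE -expr2 lerDl.
    by apply: sumr_ge0 => i _; rewrite [X in _ * X]mxE -expr2 sqr_ge0.
have [l Ul] := choice coord.
have UE k : exists x, Omega x /\ row_mx x (f x)%:M = U k.
  by have [x Ox xU] := UM k; exists x.
have [y yE] := choice UE.
pose x : 'rV[R]_n := \row_i l (lshift 1 i).
have yx : y k @[k --> \oo] --> x.
  apply: cvg_rV => i; rewrite mxE.
  rewrite (_ : (fun k => y k 0 i) = fun k => U k 0 (lshift 1 i)); first exact: Ul.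
  by apply/funext => k; rewrite -(yE k).2 row_mxEl.
have fyz : f (y k) @[k --> \oo] --> l (rshift n 0).
  rewrite (_ : (fun k => f (y k)) = fun k => U k 0 (rshift n 0)); first exact: Ul.
  by apply/funext => k; rewrite -(yE k).2 row_mxEr mxE eqxx mulr1n.
have Ox : Omega x.
  rewrite OE /=; apply: lt_le_trans (expR_gt0 (c * l (rshift n 0))) _.
  have cf : c * f (y k) @[k --> \oo] --> c * l (rshift n 0).
    by apply: cvgM => //; exact: cvg_cst.
  have ecf : expR (c * f (y k)) @[k --> \oo] --> expR (c * l (rshift n 0)).
    exact: (cvg_comp _ _ cf (@continuous_expR R _)).
  have uy : u (y k) @[k --> \oo] --> u x by exact: (cvg_comp _ _ yx (uc x)).
  apply: (ler_cvg_to ecf uy).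
  by near=> k; apply: fu; exact: (yE k).1.
pose Phi (z : 'rV[R]_n) : 'rV[R]_(n + 1) := row_mx z (f z)%:M.
pose dPhi (j : 'I_(n + 1)) (z v : 'rV[R]_n) : R :=
  match fintype.split j with inl i => v 0 i | inr _ => df z v end.
exists (Phi x); first by exists x.
rewrite (_ : (fun k => _) =
  fun k => riem_dist (graph_of Omega f) (fun=> 1%:M) (Phi (y k)) (Phi x)); last first.
  by apply/funext => k; rewrite -(yE k).2.
apply: (riem_dist_cvg0 (Omega := Omega) (dPhi := dPhi) g_cts) => //.
- by move=> z Oz; exists z.
- move=> j; rewrite /Phi /dPhi; case: (fintype.splitP j) => i ji.
    apply: elementary_ext (elementary_coord _ i) _ _ => // z.
    by rewrite (_ : j = lshift 1 i) ?row_mxEl//; exact/val_inj.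
  apply: elementary_ext fdf _ _ => // z.
  rewrite (_ : j = rshift n i) ?row_mxEr ?(ord1 i) ?mxE ?eqxx ?mulr1n//.
  by apply/val_inj; rewrite /= ji (ord1 i).
Unshelve. all: by end_near. Qed.

End euclidean.

(** * The inverse hyperbolic sine *)
Section asinh.
Context (R : realType).
Implicit Types z : R.

(** The square root of [1 + z^2], written with [expR] and [ln] so that it is
elementary. *)
Definition hypot z : R := expR (ln (1 + z ^+ 2) / 2).

Definition asinh z : R := ln (z + hypot z).

Definition sinh z : R := (expR z - expR (- z)) / 2.

Let sqr1_gt0 z : 0 < 1 + z ^+ 2.
Proof. by rewrite ltr_pwDl// sqr_ge0. Qed.

Lemma hypot_gt0 z : 0 < hypot z. Proof. exact: expR_gt0. Qed.

Lemma sqr_hypot z : hypot z ^+ 2 = 1 + z ^+ 2.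
Proof.
by rewrite /hypot -expRM_natr divfK ?pnatr_eq0// lnK// posrE.
Qed.

Lemma hypot_ge1 z : 1 <= hypot z.
Proof.
have w0 := hypot_gt0 z; have z0 := sqr_ge0 z; have wz := sqr_hypot z.
by rewrite leNgt; apply/negP => w1; nra.
Qed.

Lemma norm_le_hypot z : `|z| <= hypot z.
Proof.
have w0 := hypot_gt0 z; have wz := sqr_hypot z.
by rewrite leNgt; apply/negP => w1; have := real_normK (num_real z); nra.
Qed.

Lemma asinh_arg_gt0 z : 0 < z + hypot z.
Proof.
have w0 := hypot_gt0 z; have wz := sqr_hypot z.
by rewrite ltNge; apply/negP => zw; nra. Qed.

Lemma asinhK : cancel asinh sinh.
Proof.
move=> z; rewrite /sinh expRN /asinh lnK ?posrE ?asinh_arg_gt0//.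
have -> : (z + hypot z)^-1 = hypot z - z.
  apply: (mulfI (lt0r_neq0 (asinh_arg_gt0 z))).
  rewrite divff ?lt0r_neq0 ?asinh_arg_gt0//.
  by have := sqr_hypot z; lra.
by field.
Qed.

Lemma continuous_sinh : continuous sinh.
Proof.
move=> z; apply: cvgM; last exact: cvg_cst.
apply: cvgB; first exact: continuous_expR.
have cN : - y @[y --> z] --> - z by apply: cvgN; exact: cvg_id.
exact: (cvg_comp _ _ cN (@continuous_expR R _)).
Qed.

Lemma asinh_elementary m (M : set 'rV[R]_m) f df : elementary M f df ->
  elementary M (fun x => asinh (f x)) (fun x v => (hypot (f x))^-1 * df x v).
Proof.
move=> fdf.
have sq := elementaryD (elementary_cst M 1) (elementaryX 2 fdf).
have hy := elementary_expR (elementaryM (elementary_ln sq (fun x _ => sqr1_gt0 (f x)))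
  (elementary_cst M 2^-1)).
have lhy := elementary_ln (elementaryD fdf hy) (fun x _ => asinh_arg_gt0 (f x)).
apply: elementary_ext lhy _ _ => [x //|x v] /=.
rewrite -/(hypot (f x)) mulr0 !add0r expr1.
have w0 := lt0r_neq0 (hypot_gt0 (f x)).
have a0 := lt0r_neq0 (asinh_arg_gt0 (f x)).
rewrite -sqr_hypot; field.
by rewrite w0 a0.
Qed.

End asinh.

(** * Completeness of the potentials *)
Section model_completeness.
Context (R : realType) (n : nat) (i1 : 'I_n) (r s : R).
Hypothesis rs : (r = 1 /\ s = 0) \/ (r = 0 /\ s = 1).

Local Notation Omega := (height_domain i1 r).
Local Notation f := (potential i1 r s).
Local Notation u := (height i1 r).
Local Notation du := (dheight i1 r).

Let hessian_cts x i j : Omega x -> {for x, continuous (fun y => hessian f y i j)}.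
Proof.
by move=> Ox; exact: (elementary_hessian_continuous (@height_domain_open _ _ i1 r)
  (potential_elementary i1 r s) Ox).
Qed.

Lemma euclidean_complete_potential : euclidean_complete Omega f.
Proof.
apply: (euclidean_complete_blowup (c := - 4) (@height_domain_open _ _ i1 r)
  (potential_elementary i1 r s) (u := u)) => //.
  by move=> x; exact: (elementary_continuous (height_elementary i1 r setT)).
move=> x Ox; rewrite -[leRHS]lnK ?posrE// ler_expR /potential.
have : 0 <= s * \sum_(k < n | k != i1) x 0 k ^+ 2 / (2 * u x).
  apply: mulr_ge0; first by case: rs => -[_ ->].
  apply: sumr_ge0 => k _; rewrite divr_ge0 ?sqr_ge0// mulr_ge0//.
  exact: ltW.
by set a := s * _; set b := ln _; lra.
Qed.

(** The Hessian is a sum of squares, hence dominates each of them. *)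
Lemma coframe_bound x v k : Omega x ->
  weight i1 r s x 0 k * coframe i1 r s x v k ^+ 2 <= quad_form (hessian f x) v.
Proof.
move=> Ox; rewrite quad_form_hessian// (bigD1 k)//= lerDl.
by apply: sumr_ge0 => j _; rewrite mulr_ge0 ?sqr_ge0// ltW// weight_gt0.
Qed.

Lemma dln_height_bound x v : Omega x ->
  `|(u x)^-1 * du x v| <= 2 * Num.sqrt (quad_form (hessian f x) v).
Proof.
move=> Ox; apply: norm_le_sqrt => //; have := coframe_bound v i1 Ox.
by rewrite /coframe mxE eqxx; set Q := quad_form _ _; rewrite exprMn; lra.
Qed.

(** The exponential is [1 / sqrt u].  The functions [x_k / sqrt u] for [k != i1] form with
[ln u] global coordinates of the domain. *)
Definition ratio (k : 'I_n) (x : 'rV[R]_n) : R := x 0 k * expR (- (ln (u x) / 2)).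

Definition dratio (k : 'I_n) (x v : 'rV[R]_n) : R :=
  expR (- (ln (u x) / 2)) * (v 0 k - x 0 k / 2 * ((u x)^-1 * du x v)).

Lemma ratio_elementary k : elementary Omega (ratio k) (dratio k).
Proof.
have e := elementary_expR (elementaryN (elementaryM
  (elementary_ln (height_elementary i1 r Omega) (fun x Ox => Ox))
  (elementary_cst Omega 2^-1))).
apply: elementary_ext (elementaryM (elementary_coord Omega k) e) _ _ => // x v.
by rewrite /dratio /=; set q := (u x)^-1; field.
Qed.

(** The differential of [x_k / sqrt u] is
[omega_k / sqrt u + (s - 1/2) (x_k / sqrt u) du / u], at most [2 + |x_k / sqrt u|] times
the norm for the Hessian metric: it grows linearly, which the derivative of [asinh]
compensates. *)
Lemma dasinh_ratio_bound k x v : k != i1 -> Omega x ->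
  `|(hypot (ratio k x))^-1 * dratio k x v| <=
    3 * Num.sqrt (quad_form (hessian f x) v).
Proof.
move=> k1 Ox; set S := Num.sqrt _.
have w0 := hypot_gt0 (ratio k x).
rewrite normrM gtr0_norm ?invr_gt0// mulrC ler_pdivrMr//.
pose e := expR (- (ln (u x) / 2)).
have e2 : e ^+ 2 = (u x)^-1.
  rewrite /e -expRM_natr mulNr divfK ?pnatr_eq0// expRN lnK//.
have e0 : 0 < e by exact: expR_gt0.
have bw : `|e * coframe i1 r s x v k| <= 2 * S.
  apply: norm_le_sqrt => //; have := coframe_bound v k Ox.
  rewrite mxE (negbTE k1) exprMn e2; set Q := quad_form _ _; set c := coframe _ _ _ _ _ _.
  have : 0 <= (u x)^-1 * c ^+ 2 by rewrite mulr_ge0 ?sqr_ge0// invr_ge0 ltW.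
  by case: rs => -[-> ->]; lra.
have bu : `|(u x)^-1 * du x v| <= 2 * S by exact: dln_height_bound.
have -> : dratio k x v = e * coframe i1 r s x v k
    + (s - 1 / 2) * ratio k x * ((u x)^-1 * du x v).
  by rewrite /dratio /ratio /coframe (negbTE k1) -/e; set q := (u x)^-1; field.
have bs : `|s - 1 / 2| <= 1 / 2.
  by case: rs => -[_ ->]; rewrite ler_norml; apply/andP; split; lra.
apply: le_trans (ler_normD _ _) _.
have S0 : 0 <= S by exact: sqrtr_ge0.
have := hypot_ge1 (ratio k x); have := norm_le_hypot (ratio k x).
set w := hypot _; set z := `|ratio k x| => zw w1.
have z0 : 0 <= z by exact: normr_ge0.
have : `|(s - 1 / 2) * ratio k x * ((u x)^-1 * du x v)| <= 1 / 2 * z * (2 * S).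
  by rewrite 2!normrM -/z ler_pM ?mulr_ge0// ler_wpM2r.
by nra.
Qed.

(** The limits of [ln u] and of the [asinh (x_k / sqrt u)] give those of [u] and of the
[x_k], and then that of [x_1 = u + r * sum_(k != 1) x_k^2 / 2].  The limit of [u] is an
exponential, so the limit point lies in the domain. *)
Lemma calabi_complete_potential : calabi_complete Omega f.
Proof.
move=> U UO UC.
have [l Ul] : exists l : R, ln (u (U k)) @[k --> \oo] --> l.
  have le := elementary_ln (height_elementary i1 r Omega) (fun x Ox => Ox).
  exact: (lipschitz_cauchy_cvg hessian_cts _ le dln_height_bound UC).
have /choice[m Um] : forall k, exists m : R, k != i1 ->
    asinh (ratio k (U j)) @[j --> \oo] --> m.
  move=> k; have [->|k1] := eqVneq k i1; first by exists 0.
  have ae := asinh_elementary (ratio_elementary k).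
  have [m ?] := lipschitz_cauchy_cvg hessian_cts (ltW (ltr0Sn _ 2)) ae
    (fun x v => @dasinh_ratio_bound k x v k1) UC.
  by exists m.
pose y k := sinh (m k) * expR (l / 2).
pose x : 'rV[R]_n := \row_k if k == i1 then
  expR l + r * \sum_(k < n | k != i1) y k ^+ 2 / 2 else y k.
have ux : u x = expR l.
  rewrite /height mxE eqxx [in X in _ - X](eq_bigr (fun k => y k ^+ 2 / 2)) ?addrK//.
  by move=> k /negbTE k1; rewrite mxE k1.
have Ox : Omega x by rewrite /height_domain /= ux expR_gt0.
have coord k : k != i1 -> U j 0 k @[j --> \oo] --> y k.
  move=> k1.
  rewrite (_ : (fun j => U j 0 k) =
    fun j => sinh (asinh (ratio k (U j))) * expR (ln (u (U j)) / 2)); last first.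
    apply/funext => j; rewrite asinhK /ratio -mulrA -expRD addNr expR0 mulr1//.
  apply: cvgM; first exact: (cvg_comp _ _ (Um k k1) (@continuous_sinh R _)).
  have l2 : ln (u (U j)) / 2 @[j --> \oo] --> l / 2.
    by apply: cvgM => //; exact: cvg_cst.
  exact: (cvg_comp _ _ l2 (@continuous_expR R _)).
have Ux : U k @[k --> \oo] --> x.
  apply: cvg_rV => k; rewrite mxE; case: ifPn => [/eqP ->|k1]; last exact: coord.
  rewrite (_ : (fun j => U j 0 i1) = fun j => expR (ln (u (U j)))
    + r * \sum_(k < n | k != i1) U j 0 k ^+ 2 / 2); last first.
    by apply/funext => j; rewrite lnK ?posrE; [rewrite /height subrK | exact: UO].
  apply: cvgD; first exact: (cvg_comp _ _ Ul (@continuous_expR R _)).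
  apply: cvgM; first exact: cvg_cst.
  apply: cvg_sumr => i i1'; apply: cvgM; last exact: cvg_cst.
  rewrite expr2; under eq_cvg do rewrite expr2.
  by apply: cvgM; exact: coord.
exists x => //.
apply: (riem_dist_cvg0 (Phi := id) (dPhi := fun j _ v => v 0 j) hessian_cts
  (@height_domain_open _ _ i1 r)) => //.
by move=> j; exact: elementary_coord.
Qed.

End model_completeness.

(** * The two examples *)

(** On the axis of [x_1], the potential is [- (1/4) ln t], and a logarithm is no
quadratic polynomial of [t]: its values at [1], [2], [4], [8] are in arithmetic
progression, and a quadratic polynomial with this property is constant. *)
Lemma potential_not_quadratic (R : realType) (n : nat) (i1 : 'I_n) (r s : R) :
  ~ quadratic_on (height_domain i1 r) (potential i1 r s).
Proof.
move=> [A [b [c fE]]]; pose e : 'rV[R]_n := delta_mx 0 i1.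
have te0 (t : R) k : k != i1 -> (t *: e) 0 k = 0.
  by move=> /negbTE k1; rewrite !mxE k1 andbF mulr0.
have ht t : height i1 r (t *: e) = t.
  rewrite /height big1 => [|k k1]; last by rewrite te0// expr0n mul0r.
  by rewrite mulr0 subr0 !mxE !eqxx mulr1.
have lnE t : 0 < t -> - (1 / 4) * ln t = t ^+ 2 * quad_form A e + t * (b *m e^T) 0 0 + c.
  move=> t0; have /fE : height_domain i1 r (t *: e) by rewrite /height_domain /= ht.
  rewrite /potential ht big1 => [|k k1]; last by rewrite te0// expr0n mul0r.
  rewrite mulr0 addr0 => ->; congr (_ + _ + _).
    by rewrite /quad_form linearZ /= -!scalemxAl -scalemxAr scalerA mxE expr2.
  by rewrite linearZ /= -scalemxAr mxE.
have ln2 : 0 < ln (2 : R) by rewrite ln_gt0// ltr1n.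
have := lnE 1 ltr01; have := lnE 2 (ltr0Sn _ _).
have := lnE (2 ^+ 2) (exprn_gt0 _ (ltr0Sn _ _)).
have := lnE (2 ^+ 3) (exprn_gt0 _ (ltr0Sn _ _)).
rewrite ln1 !lnXn ?ltr0n//; move: ln2.
set L := ln 2; set p := quad_form A e; set q := (_ *m _) _ _.
by lra.
Qed.

Theorem theorem1p3 (R : realType) (n : nat) (hn : (1 < n)%N) :
  let i1 : 'I_n := Ordinal (ltnW hn) in
  (let a : R := - (n%:R / n.+1%:R) in
   let Omega : set 'rV[R]_n :=
     [set x : 'rV[R]_n | x 0 i1 > \sum_(k < n | k != i1) x 0 k ^+ 2 / 2] in
   let f : 'rV[R]_n -> R := fun x =>
     - (1 / 4) * ln (x 0 i1 - \sum_(k < n | k != i1) x 0 k ^+ 2 / 2) in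
   [/\ affine_maximal_type a Omega f,
       ~ quadratic_on Omega f,
       euclidean_complete Omega f,
       calabi_complete Omega f &
       abreu Omega f (- (4 * n.+1%:R))]) /\
  (let a : R := - (1 / n.+1%:R) in
   let Omega : set 'rV[R]_n := [set x : 'rV[R]_n | x 0 i1 > 0] in
   let f : 'rV[R]_n -> R := fun x =>
     - (1 / 4) * ln (x 0 i1)
     + \sum_(k < n | k != i1) x 0 k ^+ 2 / (2 * x 0 i1) in
   [/\ affine_maximal_type a Omega f,
       ~ quadratic_on Omega f,
       euclidean_complete Omega f,
       calabi_complete Omega f &
       abreu Omega f (- (4 * n%:R * n.+1%:R))]).
Proof.
move=> i1; have n1_neq0 : n.+1%:R != 0 :> R by rewrite pnatr_eq0.
have nE : n.-1.+1 = n by rewrite prednK// ltnW.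
split=> a Omega f.
- have rs : ((1 : R) = 1 /\ (0 : R) = 0) \/ ((1 : R) = 0 /\ (0 : R) = 1) by left.
  have -> : Omega = height_domain i1 1.
    by apply/funext => x; rewrite /Omega /height_domain /height /= mul1r subr_gt0.
  have -> : f = potential i1 1 0.
    apply/funext => x; rewrite /f /potential /height mul0r addr0.
    by rewrite (mul1r (\sum_(k < n | _) _)).
  split.
  + apply: (affine_maximal_potential rs _ (p := n.-1)) => //.
    * by rewrite oppr_eq0 mulf_neq0 ?invr_eq0// pnatr_eq0 -lt0n ltnW.
    * by rewrite /a mulNr divfK// nE.
    * by rewrite mul1r.
  + exact: potential_not_quadratic.
  + exact: euclidean_complete_potential rs.
  + exact: calabi_complete_potential rs.
  + apply: (abreu_potential rs) => //.
    have h : n%:R = n.-1%:R + 1 :> R by rewrite natr1 nE.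
    by rewrite mul1r h addrAC subrr add0r mulr1.
- have rs : ((0 : R) = 1 /\ (1 : R) = 0) \/ ((0 : R) = 0 /\ (1 : R) = 1) by right.
  have heightE x : height i1 0 x = x 0 i1 by rewrite /height mul0r subr0.
  have -> : Omega = height_domain i1 0.
    by apply/funext => x; rewrite /Omega /height_domain /= heightE.
  have -> : f = potential i1 0 1.
    by apply/funext => x; rewrite /f /potential heightE (mul1r (\sum_(k < n | _) _)).
  split.
  + apply: (affine_maximal_potential rs _ (p := 0%N)) => //.
    * by rewrite oppr_eq0 mulf_neq0 ?invr_eq0 ?oner_eq0.
    * by rewrite /a mulNr divfK.
    * by rewrite mul0r.
  + exact: potential_not_quadratic.
  + exact: euclidean_complete_potential rs.
  + exact: calabi_complete_potential rs.
  + apply: (abreu_potential rs) => //.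
    by rewrite mul0r subr0; ring.
Qed.
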